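(* Let $A=B=C=1$. There exist a real number $\tau\in[7.797656,\,7.797666]$ and a solution $(x,y,z):\mathbb{R}\to\mathbb{R}^3$ of the ABC flow $$x'=A\sin(z)+C\cos(y),\qquad y'=B\sin(x)+A\cos(z),\qquad z'=C\sin(y)+B\cos(x)$$ such that $$x(t+\tau)=x(t)+4\pi,\quad y(t+\tau)=y(t),\quad z(t+\tau)=z(t)\quad\text{for all } t\in\mathbb{R},$$ and $x(\cdot+\tau)\neq x(\cdot)+2\pi$ (as functions on $\mathbb{R}$).
   Context: All numbers are exact decimal numbers. A solution of the ABC flow is a differentiable map $(x,y,z):\mathbb{R}\to\mathbb{R}^3$ satisfying the displayed system of ordinary differential equations for all $t\in\mathbb{R}$. *)

(* Defs.v *)
From Stdlib Require Import Reals.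
From Coquelicot Require Import Coquelicot.
Open Scope R_scope.

(* Differentiability of the map (x, y, z) : R -> R^3 is componentwise, and is
   part of [is_derive]. *)
Definition is_ABC_solution (A B C : R) (x y z : R -> R) : Prop :=
  forall t : R,
    is_derive x t (A * sin (z t) + C * cos (y t)) /\
    is_derive y t (B * sin (x t) + A * cos (z t)) /\
    is_derive z t (C * sin (y t) + B * cos (x t)).

(* Main.v *)
From Stdlib Require Import Reals Lra Lia Psatz ZArith List Bool Machin.
From Coquelicot Require Import Coquelicot.
Require Import Defs.
Import ListNotations.
Open Scope R_scope.

(** The map [(x, y, z) -> (2 m - x, PI / 2 - z, PI / 2 - y)] with [m = PI / 4 + 2 k PI] reverses
    the flow, and its fixed points form the line [x = m], [y + z = PI / 2].  A trajectory that goes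
    from the line with [k = 0] at time 0 to the line with [k = 1] at time [T] is invariant under
    both reversals, hence under their composition, which is the translation by [2 T] in time and
    by [4 PI] in [x] ([symmetric_arc_periodic]).  It remains to find such a trajectory with [2 T]
    in the given interval; the last claim is then clear because [4 PI] is not [2 PI].

    The trajectories starting on the first line form a one-parameter family [launch].  Near the
    time 3.89883, and for parameters in a certain interval of length at most [2.4e-10], the
    coordinate [x] is increasing and passes through [PI / 4 + 2 PI].  The value of
    [y + z - PI / 2] at this passage depends continuously on the parameter and has opposite signs
    at the two ends of the interval, so the intermediate value theorem gives the required
    parameter ([shooting], [symmetric_arc_exists]).

    All estimates rest on one Groenwall inequality, [tracking], which compares a true solution with
    an approximate one.  For two true solutions it gives uniqueness and continuous dependence,
    hence control of the whole family by a single member.  For the two extreme members it is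
    applied to piecewise polynomial approximations with integer coefficients, in fixed-point
    representation.  These carry approximations of the sines and cosines of the coordinates, so
    that the residual of the equations is a polynomial and is bounded by the sum of the absolute
    values of its coefficients ([check_arc_sound]).  The polynomials are computed and their
    residuals checked by evaluation in [arrives_low] and [arrives_high].  Existence of solutions on
    the whole line is proved by Picard iteration ([flow_solution]). *)

(** * Comparison of approximate solutions *)

Lemma derive_nonneg_le (f df : R -> R) (a b : R) :
  a <= b -> (forall t, a <= t <= b -> is_derive f t (df t)) ->
  (forall t, a <= t <= b -> 0 <= df t) -> f a <= f b.
Proof.
intros Hab Hf Hd.
destruct (MVT_gen f a b df) as [c [Hc E]].
- intros t Ht; rewrite Rmin_left, Rmax_right in Ht by lra; apply Hf; lra.
- intros t Ht; rewrite Rmin_left, Rmax_right in Ht by lra.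
  apply continuity_pt_filterlim; apply (ex_derive_continuous f); exists (df t); apply Hf; lra.
- rewrite Rmin_left, Rmax_right in Hc by lra.
  specialize (Hd c Hc); nra.
Qed.

Lemma exp_le_exp (a b : R) : a <= b -> exp a <= exp b.
Proof.
intros [H | ->]; [left; apply exp_increasing; exact H | right; reflexivity].
Qed.

(** Groenwall's inequality on the unit interval. *)
Lemma gronwall (D dD : R -> R) (K c : R) :
  0 <= K -> 0 <= c ->
  (forall t, 0 <= t <= 1 -> is_derive D t (dD t)) ->
  (forall t, 0 <= t <= 1 -> dD t <= K * D t + c) ->
  D 1 <= exp K * (D 0 + c).
Proof.
intros HK Hc HD Hd.
assert (H : c * 0 - D 0 * exp (- K * 0) <= c * 1 - D 1 * exp (- K * 1)).
{ apply (derive_nonneg_le (fun t => c * t - D t * exp (- K * t))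
    (fun t => c - (dD t - K * D t) * exp (- K * t))); [lra | |].
  - intros t Ht; specialize (HD t Ht).
    auto_derive; [exists (dD t); exact HD |].
    rewrite (is_derive_unique (fun x : R => D x) t _ HD); ring.
  - intros t Ht; specialize (Hd t Ht).
    assert (E1 : exp (- K * t) <= 1) by (rewrite <- exp_0; apply exp_le_exp; nra).
    assert (E0 := exp_pos (- K * t)); nra. }
rewrite !Rmult_0_r, exp_0, !Rmult_1_r in H.
rewrite exp_Ropp in H.
assert (E0 := exp_pos K).
apply (Rmult_le_compat_l (exp K)) in H; [|lra].
replace (exp K * (c - D 1 * / exp K)) with (exp K * c - D 1) in H by (field; lra).
lra.
Qed.

Lemma lipschitz_of_derive_bound (f df : R -> R) (M : R) :
  (forall t, is_derive f t (df t)) -> (forall t, Rabs (df t) <= M) ->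
  forall a b, Rabs (f b - f a) <= M * Rabs (b - a).
Proof.
intros Hf Hd a b.
destruct (MVT_gen f a b df) as [c [_ E]].
- intros t _; apply Hf.
- intros t _; apply continuity_pt_filterlim.
  apply (ex_derive_continuous f); exists (df t); apply Hf.
- rewrite E, Rabs_mult; apply Rmult_le_compat_r; [apply Rabs_pos | apply Hd].
Qed.

Lemma sin_lipschitz (a b : R) : Rabs (sin b - sin a) <= Rabs (b - a).
Proof.
rewrite <- (Rmult_1_l (Rabs (b - a))).
apply (lipschitz_of_derive_bound sin cos).
- intros t; apply is_derive_sin.
- intros t; apply Rabs_le; apply COS_bound.
Qed.

Lemma cos_lipschitz (a b : R) : Rabs (cos b - cos a) <= Rabs (b - a).
Proof.
rewrite <- (Rmult_1_l (Rabs (b - a))).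
apply (lipschitz_of_derive_bound cos (fun t => - sin t)).
- intros t; apply is_derive_cos.
- intros t; rewrite Rabs_Ropp; apply Rabs_le; apply SIN_bound.
Qed.

(** ** The flow with indexed coordinates *)

(** The three coordinates are permuted cyclically by a symmetry of the flow, so they are
    indexed by [axis]: every equation reads [u_i' = sin u_{prv i} + cos u_{nxt i}]. *)
Inductive axis : Type := ax | ay | az.
Definition nxt (i : axis) : axis := match i with ax => ay | ay => az | az => ax end.
Definition prv (i : axis) : axis := match i with ax => az | ay => ax | az => ay end.
Definition field3 (w : axis -> R) (i : axis) : R := sin (w (prv i)) + cos (w (nxt i)).

(** Solutions defined on all of [R]. *)
Definition solution (u : axis -> R -> R) : Prop :=
  forall i t, is_derive (u i) t (field3 (fun j => u j t) i).

Definition sum3 (f : axis -> R) : R := f ax + f ay + f az.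

Lemma field3_bound w i : Rabs (field3 w i) <= 2.
Proof.
unfold field3; apply Rabs_le.
pose proof (SIN_bound (w (prv i))); pose proof (COS_bound (w (nxt i))); lra.
Qed.

Lemma field3_lipschitz v w i :
  Rabs (field3 v i - field3 w i)
    <= Rabs (v (prv i) - w (prv i)) + Rabs (v (nxt i) - w (nxt i)).
Proof.
unfold field3.
replace (_ - _) with ((sin (v (prv i)) - sin (w (prv i)))
  + (cos (v (nxt i)) - cos (w (nxt i)))) by ring.
eapply Rle_trans; [apply Rabs_triang |].
apply Rplus_le_compat; [apply sin_lipschitz | apply cos_lipschitz].
Qed.

(** The functional that controls all errors.  Here [u] is a true coordinate, [v] an approximation
    of it, and [c], [s] approximations of [cos v] and [sin v].  The weight 4 keeps the growth rate
    of the sum over the axes at most [9 / 2], barely above the rate 4 that the Lipschitz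
    constants give for two solutions. *)
Definition mismatch (u v c s : R) : R :=
  (u - v) ^ 2 + 4 * ((c - cos v) ^ 2 + (s - sin v) ^ 2).

Definition gap (u v c s : axis -> R -> R) (t : R) : R :=
  sum3 (fun i => mismatch (u i t) (v i t) (c i t) (s i t)).

Lemma mismatch_ge_squares u v c s :
  (u - v) ^ 2 <= mismatch u v c s /\ (c - cos v) ^ 2 <= mismatch u v c s
  /\ (s - sin v) ^ 2 <= mismatch u v c s.
Proof.
unfold mismatch; pose proof (pow2_ge_0 (u - v)); pose proof (pow2_ge_0 (c - cos v));
  pose proof (pow2_ge_0 (s - sin v)); lra.
Qed.

Lemma mismatch_ge_0 u v c s : 0 <= mismatch u v c s.
Proof. destruct (mismatch_ge_squares u v c s); pose proof (pow2_ge_0 (u - v)); lra. Qed.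

Lemma sum3_le f g : (forall i, f i <= g i) -> sum3 f <= sum3 g.
Proof. intros H; unfold sum3; pose proof (H ax); pose proof (H ay); pose proof (H az); lra. Qed.

Lemma is_derive_sum3 (f : axis -> R -> R) (df : axis -> R) t :
  (forall i, is_derive (f i) t (df i)) ->
  is_derive (fun t => sum3 (fun i => f i t)) t (sum3 df).
Proof.
intros H; unfold sum3.
apply (is_derive_plus (fun t => f ax t + f ay t) (f az)); [|apply H].
apply (is_derive_plus (f ax) (f ay)); apply H.
Qed.

Lemma young (a b m : R) : 0 < m -> a * b <= m * a ^ 2 + b ^ 2 / (4 * m).
Proof.
intros Hm.
assert (0 <= (2 * m * a - b) ^ 2 / (4 * m)).
{ apply Rmult_le_pos; [apply pow2_ge_0 | left; apply Rinv_0_lt_compat; lra]. }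
replace ((2 * m * a - b) ^ 2 / (4 * m)) with (m * a ^ 2 + b ^ 2 / (4 * m) - a * b) in H
  by (field; lra).
lra.
Qed.

(** Comparison of a solution, run at speed [h] over the time interval [[0, 1]], with an approximate
    one that carries its own approximate cosines and sines.  The three residuals are those of
    [v_i' = h (s_{prv i} + c_{nxt i})], [c_i' = - s_i v_i'] and [s_i' = c_i v_i']; since the last two
    describe a rotation, the distance of [(c, s)] to [(cos v, sin v)] changes only through their residuals.
    With residual zero the lemma also compares two solutions. *)
Lemma tracking (u v c s dv dc ds : axis -> R -> R) (h kappa eps : R) :
  0 < kappa -> Rabs h <= kappa ->
  (forall i t, 0 <= t <= 1 -> is_derive (u i) t (h * field3 (fun j => u j t) i)) ->
  (forall i t, 0 <= t <= 1 -> is_derive (v i) t (dv i t)) ->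
  (forall i t, 0 <= t <= 1 -> is_derive (c i) t (dc i t)) ->
  (forall i t, 0 <= t <= 1 -> is_derive (s i) t (ds i t)) ->
  (forall i t, 0 <= t <= 1 -> Rabs (dv i t - h * (s (prv i) t + c (nxt i) t)) <= eps) ->
  (forall i t, 0 <= t <= 1 -> Rabs (dc i t + s i t * dv i t) <= eps) ->
  (forall i t, 0 <= t <= 1 -> Rabs (ds i t - c i t * dv i t) <= eps) ->
  gap u v c s 1 <= exp (9 / 2 * kappa) * (gap u v c s 0 + 60 * eps ^ 2 / kappa).
Proof.
intros kappa_pos h_le Hu Hv Hc Hs Rv Rc Rs.
set (p := fun i t => c i t - cos (v i t)).
set (q := fun i t => s i t - sin (v i t)).
assert (eps_pos : 0 <= eps).
{ eapply Rle_trans; [apply Rabs_pos | apply (Rv ax 0); lra]. }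
apply (gronwall _ (fun t => sum3 (fun i =>
   2 * (u i t - v i t) * (h * field3 (fun j => u j t) i - dv i t)
   + 8 * (p i t * (dc i t + s i t * dv i t) + q i t * (ds i t - c i t * dv i t))))).
- lra.
- apply Rmult_le_pos; [nra | left; apply Rinv_0_lt_compat; lra].
- intros t Ht; unfold gap; apply (is_derive_sum3 (fun i t => mismatch (u i t) (v i t) (c i t) (s i t))).
  intros i; unfold mismatch.
  specialize (Hu i t Ht); specialize (Hv i t Ht); specialize (Hc i t Ht); specialize (Hs i t Ht).
  auto_derive.
  + repeat split; eexists; eassumption.
  + rewrite (is_derive_unique (fun x : R => u i x) t _ Hu), (is_derive_unique (fun x : R => v i x) t _ Hv),
      (is_derive_unique (fun x : R => c i x) t _ Hc), (is_derive_unique (fun x : R => s i x) t _ Hs).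
    unfold p, q; ring.
- intros t Ht.
  set (a := fun i => Rabs (u i t - v i t)).
  set (P := fun i => Rabs (p i t)); set (Q := fun i => Rabs (q i t)).
  assert (B : forall i,
    2 * (u i t - v i t) * (h * field3 (fun j => u j t) i - dv i t)
    + 8 * (p i t * (dc i t + s i t * dv i t) + q i t * (ds i t - c i t * dv i t))
    <= kappa * (2 * a i ^ 2 + a (prv i) ^ 2 + a (nxt i) ^ 2 + a i ^ 2 / 2
         + 8 * (Q (prv i) ^ 2 + P (nxt i) ^ 2) + 2 * (P i ^ 2 + Q i ^ 2))
       + 20 * (eps ^ 2 / kappa)).
  { intros i.
    assert (Hd : Rabs (h * field3 (fun j => u j t) i - dv i t)
      <= kappa * (a (prv i) + Q (prv i) + a (nxt i) + P (nxt i)) + eps).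
    { replace (h * field3 (fun j => u j t) i - dv i t) with
        (h * ((sin (u (prv i) t) - sin (v (prv i) t)) - q (prv i) t
              + (cos (u (nxt i) t) - cos (v (nxt i) t)) - p (nxt i) t)
         - (dv i t - h * (s (prv i) t + c (nxt i) t)))
        by (unfold field3, p, q; ring).
      unfold Rminus at 1; eapply Rle_trans; [apply Rabs_triang |].
      rewrite Rabs_Ropp; apply Rplus_le_compat; [|apply Rv; exact Ht].
      rewrite Rabs_mult; apply Rmult_le_compat; try apply Rabs_pos; [exact h_le |].
      pose proof (sin_lipschitz (v (prv i) t) (u (prv i) t)) as L1.
      pose proof (cos_lipschitz (v (nxt i) t) (u (nxt i) t)) as L2.
      unfold a, P, Q; revert L1 L2; clear.
      unfold Rabs; repeat destruct Rcase_abs; lra. }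
    assert (H1 : (u i t - v i t) * (h * field3 (fun j => u j t) i - dv i t)
      <= a i * (kappa * (a (prv i) + Q (prv i) + a (nxt i) + P (nxt i)) + eps)).
    { eapply Rle_trans; [apply Rle_abs |]; rewrite Rabs_mult.
      apply Rmult_le_compat_l; [apply Rabs_pos | exact Hd]. }
    assert (H2 : p i t * (dc i t + s i t * dv i t) <= P i * eps).
    { eapply Rle_trans; [apply Rle_abs |]; rewrite Rabs_mult.
      apply Rmult_le_compat_l; [apply Rabs_pos | apply Rc; exact Ht]. }
    assert (H3 : q i t * (ds i t - c i t * dv i t) <= Q i * eps).
    { eapply Rle_trans; [apply Rle_abs |]; rewrite Rabs_mult.
      apply Rmult_le_compat_l; [apply Rabs_pos | apply Rs; exact Ht]. }
    (* The products are split with such weights that, in the sum over the axes, the coefficients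
       of the squares are at most 9 / 2 times those in [gap]. *)
    pose proof (young (a i) eps (kappa / 8) ltac:(lra)) as Y1.
    pose proof (young (P i) eps (kappa / 4) ltac:(lra)) as Y2.
    pose proof (young (Q i) eps (kappa / 4) ltac:(lra)) as Y3.
    replace (eps ^ 2 / (4 * (kappa / 8))) with (2 * (eps ^ 2 / kappa)) in Y1 by (field; lra).
    replace (eps ^ 2 / (4 * (kappa / 4))) with (eps ^ 2 / kappa) in Y2, Y3 by (field; lra).
    assert (Z1 : a i * (a (prv i) + Q (prv i) + a (nxt i) + P (nxt i))
      <= a i ^ 2 + a (prv i) ^ 2 / 2 + a (nxt i) ^ 2 / 2 + a i ^ 2 / 8
         + 4 * (Q (prv i) ^ 2 + P (nxt i) ^ 2)).
    { pose proof (young (a i) (a (prv i)) (1/2) ltac:(lra)).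
      pose proof (young (a i) (a (nxt i)) (1/2) ltac:(lra)).
      pose proof (young (a i) (Q (prv i)) (1/16) ltac:(lra)).
      pose proof (young (a i) (P (nxt i)) (1/16) ltac:(lra)).
      lra. }
    apply (Rmult_le_compat_l kappa) in Z1; [|lra].
    lra. }
  eapply Rle_trans; [apply sum3_le; exact B |].
  assert (F : forall i, mismatch (u i t) (v i t) (c i t) (s i t)
     = a i ^ 2 + 4 * (P i ^ 2 + Q i ^ 2)).
  { intros i; unfold mismatch, a, P, Q, p, q; rewrite !pow2_abs; reflexivity. }
  unfold gap, sum3; rewrite !F; simpl prv; simpl nxt; clearbody a P Q.
  assert (forall i, 0 <= P i ^ 2) by (intros; apply pow2_ge_0).
  assert (forall i, 0 <= Q i ^ 2) by (intros; apply pow2_ge_0).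
  pose proof (H ax); pose proof (H ay); pose proof (H az).
  pose proof (H0 ax); pose proof (H0 ay); pose proof (H0 az).
  replace (60 * eps ^ 2 / kappa) with (60 * (eps ^ 2 / kappa)) by (field; lra).
  generalize (eps ^ 2 / kappa); intros w; nra.
Qed.

Lemma sum3_sqr_ge (f : axis -> R) (i : axis) : (f i) ^ 2 <= sum3 (fun i => (f i) ^ 2).
Proof.
unfold sum3; pose proof (pow2_ge_0 (f ax)); pose proof (pow2_ge_0 (f ay));
  pose proof (pow2_ge_0 (f az)); destruct i; lra.
Qed.

(** ** Dependence on initial values, uniqueness *)

Lemma solution_gap (u w : axis -> R -> R) (a b h kappa : R) :
  solution u -> solution w -> 0 < kappa -> Rabs h <= kappa ->
  sum3 (fun i => (u i (a + h) - w i (b + h)) ^ 2)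
    <= exp (9 / 2 * kappa) * sum3 (fun i => (u i a - w i b) ^ 2).
Proof.
intros Su Sw Hk Hh.
assert (Hr : forall (f : axis -> R -> R), solution f -> forall d i t,
  is_derive (fun t => f i (d + h * t)) t (h * field3 (fun j => f j (d + h * t)) i)).
{ intros f Sf d i t.
  evar_last.
  - apply (is_derive_comp (f i) (fun t => d + h * t)); [apply Sf |].
    auto_derive; [exact I | reflexivity].
  - rewrite Rmult_1_r; reflexivity. }
set (v := fun i t => w i (b + h * t)).
pose proof (tracking (fun i t => u i (a + h * t)) v
  (fun i t => cos (v i t)) (fun i t => sin (v i t))
  (fun i t => h * field3 (fun j => v j t) i)
  (fun i t => - sin (v i t) * (h * field3 (fun j => v j t) i))
  (fun i t => cos (v i t) * (h * field3 (fun j => v j t) i)) h kappa 0 Hk Hh) as T.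
replace (60 * 0 ^ 2 / kappa) with 0 in T by (field; lra).
assert (G : forall t, gap (fun i t => u i (a + h * t)) v
  (fun i t => cos (v i t)) (fun i t => sin (v i t)) t
  = sum3 (fun i => (u i (a + h * t) - w i (b + h * t)) ^ 2)).
{ intros t; unfold gap, mismatch, sum3, v; ring. }
rewrite !G, !Rmult_1_r, Rmult_0_r, !Rplus_0_r in T.
apply T; clear T G.
- intros i t _; apply (Hr u Su).
- intros i t _; apply (Hr w Sw).
- intros i t _; evar_last.
  + apply (is_derive_comp cos (v i)); [apply is_derive_cos | apply (Hr w Sw)].
  + unfold scal; simpl; unfold mult; simpl; fold v; unfold v; ring.
- intros i t _; evar_last.
  + apply (is_derive_comp sin (v i)); [apply is_derive_sin | apply (Hr w Sw)].
  + unfold scal; simpl; unfold mult; simpl; fold v; unfold v; ring.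
- intros i t _; unfold field3; rewrite Rminus_diag; rewrite Rabs_R0; lra.
- intros i t _; right; rewrite <- Rabs_R0; f_equal; ring.
- intros i t _; right; rewrite <- Rabs_R0; f_equal; ring.
Qed.

Lemma solution_unique (u w : axis -> R -> R) (a : R) :
  solution u -> solution w -> (forall i, u i a = w i a) -> forall i t, u i t = w i t.
Proof.
intros Su Sw E i t.
pose proof (solution_gap u w a a (t - a) (Rabs (t - a) + 1) Su Sw) as H.
assert (H0 : sum3 (fun i => (u i a - w i a) ^ 2) = 0).
{ unfold sum3; rewrite !E; ring. }
rewrite H0, Rmult_0_r in H.
pose proof (Rabs_pos (t - a)).
specialize (H ltac:(lra) ltac:(lra)).
replace (a + (t - a)) with t in H by ring.
pose proof (sum3_sqr_ge (fun i => u i t - w i t) i) as Sq; cbv beta in Sq.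
assert (u i t - w i t = 0).
{ apply Rsqr_0_uniq; rewrite Rsqr_pow2.
  pose proof (pow2_ge_0 (u i t - w i t)); lra. }
lra.
Qed.

Lemma solution_dependence (u w : axis -> R -> R) (i : axis) (a b h kappa L d : R) :
  solution u -> solution w -> 0 < kappa -> Rabs h <= kappa ->
  exp (9 / 2 * kappa) <= L ^ 2 -> 0 <= L -> 0 <= d ->
  sum3 (fun i => (u i a - w i b) ^ 2) <= d ^ 2 ->
  Rabs (u i (a + h) - w i (b + h)) <= L * d.
Proof.
intros Su Sw Hk Hh HL HL0 Hd0 Hd.
pose proof (solution_gap u w a b h kappa Su Sw Hk Hh) as H.
pose proof (sum3_sqr_ge (fun i => u i (a + h) - w i (b + h)) i) as Sq; cbv beta in Sq.
rewrite <- (Rabs_pos_eq (L * d)) by nra.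
apply Rsqr_le_abs_0; rewrite !Rsqr_pow2.
assert (E : exp (9 / 2 * kappa) * sum3 (fun i => (u i a - w i b) ^ 2) <= L ^ 2 * d ^ 2).
{ apply Rmult_le_compat; try assumption; [left; apply exp_pos |].
  unfold sum3; pose proof (pow2_ge_0 (u ax a - w ax b)); pose proof (pow2_ge_0 (u ay a - w ay b));
  pose proof (pow2_ge_0 (u az a - w az b)); lra. }
replace ((L * d) ^ 2) with (L ^ 2 * d ^ 2) by ring; lra.
Qed.

(** * Existence of solutions *)

(** Picard iterates, started from the constant function with value [u0]. *)
Fixpoint picard (u0 : axis -> R) (n : nat) (i : axis) (t : R) : R :=
  match n with
  | O => u0 i
  | S m => u0 i + RInt (fun s => field3 (fun j => picard u0 m j s) i) 0 t
  end.

Lemma is_derive_field_primitive (f : axis -> R -> R) (i : axis) (c : R) :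
  (forall j t, continuous (f j) t) -> forall t,
  is_derive (fun t => c + RInt (fun s => field3 (fun j => f j s) i) 0 t) t
    (field3 (fun j => f j t) i).
Proof.
intros Cf.
assert (C : forall t, continuous (fun s => field3 (fun j => f j s) i) t).
{ intros t; unfold field3.
  apply (continuous_plus (fun s => sin (f (prv i) s)) (fun s => cos (f (nxt i) s))).
  - apply (continuous_comp (f (prv i)) sin); [apply Cf | apply continuous_sin].
  - apply (continuous_comp (f (nxt i)) cos); [apply Cf | apply continuous_cos]. }
intros t.
evar_last.
- apply (is_derive_plus (fun _ => c)); [apply is_derive_const |].
  apply (is_derive_RInt (fun s => field3 (fun j => f j s) i)
    (fun t => RInt (fun s => field3 (fun j => f j s) i) 0 t) 0); [|apply C].
  apply filter_forall; intros y; apply (RInt_correct (fun s => field3 (fun j => f j s) i)).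
  apply (ex_RInt_continuous (fun s => field3 (fun j => f j s) i)); intros; apply C.
- apply plus_zero_l.
Qed.

Lemma picard_continuous u0 n i t : continuous (picard u0 n i) t.
Proof.
revert i t; induction n as [|n IH]; intros i t; simpl.
- apply continuous_const.
- apply (ex_derive_continuous (fun t => u0 i + RInt (fun s => field3 (fun j => picard u0 n j s) i) 0 t)).
  eexists; apply (is_derive_field_primitive (picard u0 n)); exact IH.
Qed.

Lemma picard_derive u0 n i t :
  is_derive (picard u0 (S n) i) t (field3 (fun j => picard u0 n j t) i).
Proof. apply (is_derive_field_primitive (picard u0 n)), picard_continuous. Qed.

Lemma picard_0 u0 n i : picard u0 n i 0 = u0 i.
Proof.
destruct n; simpl; [reflexivity |]; rewrite RInt_point; unfold zero; simpl; ring.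
Qed.

(** The Picard iteration contracts with factor [1 / 2] in the supremum norm weighted by this
    function, on the whole real line: its primitive vanishing at 0 is at most a quarter of it, and
    the field is 2-Lipschitz. *)
Definition weight (t : R) : R := exp (4 * t) + exp (- 4 * t).

Lemma weight_pos t : 0 < weight t.
Proof. unfold weight; pose proof (exp_pos (4 * t)); pose proof (exp_pos (-4 * t)); lra. Qed.

Lemma weight_ge_1 t : 1 <= weight t.
Proof.
unfold weight; pose proof (exp_pos (4 * t)); pose proof (exp_pos (-4 * t)).
destruct (Rle_dec 0 t).
- assert (exp 0 <= exp (4 * t)) by (apply exp_le_exp; lra); rewrite exp_0 in *; lra.
- assert (exp 0 <= exp (-4 * t)) by (apply exp_le_exp; lra); rewrite exp_0 in *; lra.
Qed.

Lemma bound_from_derivative (f df : R -> R) (k : R) :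
  (forall t, is_derive f t (df t)) -> f 0 = 0 -> 0 <= k ->
  (forall t, Rabs (df t) <= k * weight t) ->
  forall t, Rabs (f t) <= k / 4 * weight t.
Proof.
intros Hf H0 Hk Hd.
set (G := fun t => k / 4 * (exp (4 * t) - exp (- 4 * t))).
assert (HG : forall t, is_derive G t (k * weight t)).
{ intros t; unfold G, weight; auto_derive; [exact I |]; field. }
assert (M : forall e, e = 1 \/ e = -1 -> forall a b, a <= b -> G a + e * f a <= G b + e * f b).
{ intros e He a b Hab.
  apply (derive_nonneg_le (fun t => G t + e * f t) (fun t => k * weight t + e * df t));
    [exact Hab | |].
  - intros x _.
    apply (is_derive_plus G (fun t => e * f t)); [apply HG |].
    apply (is_derive_scal f); apply Hf.
  - intros x _; specialize (Hd x); apply Rabs_le_between in Hd.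
    destruct He; subst e; lra. }
assert (G0 : G 0 = 0) by (unfold G; rewrite !Rmult_0_r, Rminus_diag; ring).
intros t.
pose proof (exp_pos (4 * t)) as E1; pose proof (exp_pos (-4 * t)) as E2.
unfold weight; apply Rabs_le; destruct (Rle_dec 0 t) as [Ht | Ht].
- pose proof (M 1 (or_introl eq_refl) 0 t Ht); pose proof (M (-1) (or_intror eq_refl) 0 t Ht).
  unfold G in *; nra.
- assert (Ht' : t <= 0) by lra.
  pose proof (M 1 (or_introl eq_refl) t 0 Ht'); pose proof (M (-1) (or_intror eq_refl) t 0 Ht').
  unfold G in *; nra.
Qed.

Lemma picard_step u0 n i t :
  Rabs (picard u0 (S n) i t - picard u0 n i t) <= (1 / 2) ^ n * weight t.
Proof.
revert i t; induction n as [|n IH]; intros i t.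
- apply Rle_trans with (2 / 4 * weight t); [|pose proof (weight_pos t); simpl; lra].
  apply (bound_from_derivative (fun t => picard u0 1 i t - picard u0 0 i t)
     (fun t => field3 (fun j => picard u0 0 j t) i - 0)).
  + intros x; apply (is_derive_minus (picard u0 1 i)); [apply picard_derive |].
    apply (is_derive_const (u0 i)).
  + rewrite !picard_0; ring.
  + lra.
  + intros x; rewrite Rminus_0_r.
    eapply Rle_trans; [apply field3_bound |]; pose proof (weight_ge_1 x); lra.
- assert (Hp : 0 < (1/2) ^ n) by (apply pow_lt; lra).
  replace ((1 / 2) ^ S n) with (2 * (1/2) ^ n / 4) by (simpl; field).
  apply (bound_from_derivative (fun t => picard u0 (S (S n)) i t - picard u0 (S n) i t)
     (fun t => field3 (fun j => picard u0 (S n) j t) i - field3 (fun j => picard u0 n j t) i)).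
  + intros x; apply (is_derive_minus (picard u0 (S (S n)) i)); apply picard_derive.
  + rewrite !picard_0; ring.
  + lra.
  + intros x; eapply Rle_trans; [apply field3_lipschitz |].
    pose proof (IH (prv i) x); pose proof (IH (nxt i) x); lra.
Qed.

Lemma picard_tail u0 n k i t :
  Rabs (picard u0 (n + k) i t - picard u0 n i t) <= 2 * (1 / 2) ^ n * weight t.
Proof.
assert (H : Rabs (picard u0 (n + k) i t - picard u0 n i t)
  <= 2 * ((1 / 2) ^ n - (1 / 2) ^ (n + k)) * weight t).
{ induction k as [|k IH].
  - rewrite Nat.add_0_r, !Rminus_diag, Rabs_R0; lra.
  - rewrite Nat.add_succ_r.
    replace (picard u0 (S (n + k)) i t - picard u0 n i t) with
      ((picard u0 (S (n + k)) i t - picard u0 (n + k) i t)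
       + (picard u0 (n + k) i t - picard u0 n i t)) by ring.
    eapply Rle_trans; [apply Rabs_triang |].
    pose proof (picard_step u0 (n + k) i t).
    replace ((1 / 2) ^ S (n + k)) with ((1/2) ^ (n + k) / 2) by (simpl; field).
    lra. }
eapply Rle_trans; [exact H |].
apply Rmult_le_compat_r; [left; apply weight_pos |].
assert (0 < (1/2) ^ (n + k)) by (apply pow_lt; lra); lra.
Qed.

(** The solution with value [u0] at time 0. *)
Definition flow (u0 : axis -> R) (i : axis) (t : R) : R :=
  real (Lim_seq (fun n => picard u0 n i t)).

Lemma geometric_small (M e : R) : 0 < e -> exists N, M * (1 / 2) ^ N < e.
Proof.
intros He.
assert (L : is_lim_seq (fun n => M * (1/2) ^ n) 0).
{ evar_last; [apply (is_lim_seq_scal_l (fun n => (1/2) ^ n) M 0) |].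
  - apply is_lim_seq_geom; rewrite Rabs_pos_eq; lra.
  - simpl; rewrite Rmult_0_r; reflexivity. }
apply is_lim_seq_spec in L.
destruct (L (mkposreal e He)) as [N HN]; exists N.
specialize (HN N (Nat.le_refl N)); simpl in HN; rewrite Rminus_0_r in HN.
apply Rabs_lt_between in HN; lra.
Qed.

Lemma picard_cv u0 i t : is_lim_seq (fun n => picard u0 n i t) (flow u0 i t).
Proof.
apply Lim_seq_correct', ex_lim_seq_cauchy_corr.
intros e.
destruct (geometric_small (4 * weight t) e (cond_pos e)) as [N HN].
exists N; intros n m Hn Hm.
pose proof (picard_tail u0 N (n - N) i t) as A1.
pose proof (picard_tail u0 N (m - N) i t) as A2.
replace (N + (n - N))%nat with n in A1 by lia.
replace (N + (m - N))%nat with m in A2 by lia.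
revert A1 A2 HN; clear.
intros A1 A2 HN; apply Rabs_le_between in A1; apply Rabs_le_between in A2.
apply Rabs_lt_between; split; lra.
Qed.

Lemma picard_flow u0 n i t :
  Rabs (flow u0 i t - picard u0 n i t) <= 2 * (1 / 2) ^ n * weight t.
Proof.
apply (is_lim_seq_le (fun k => Rabs (picard u0 (n + k) i t - picard u0 n i t))
  (fun _ => 2 * (1 / 2) ^ n * weight t)
  (Rabs (flow u0 i t - picard u0 n i t)) (2 * (1 / 2) ^ n * weight t)).
- intros k; apply picard_tail.
- apply (is_lim_seq_abs _ (Finite (flow u0 i t - picard u0 n i t))).
  apply (is_lim_seq_minus' (fun k => picard u0 (n + k) i t) (fun _ => picard u0 n i t)).
  + apply (is_lim_seq_ext (fun k => picard u0 (k + n) i t)).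
    * intros k; rewrite Nat.add_comm; reflexivity.
    * apply (is_lim_seq_incr_n (fun k => picard u0 k i t)), picard_cv.
  + apply is_lim_seq_const.
- apply is_lim_seq_const.
Qed.

Lemma flow_0 u0 i : flow u0 i 0 = u0 i.
Proof.
unfold flow; rewrite (Lim_seq_ext _ (fun _ => u0 i)); [rewrite Lim_seq_const; reflexivity |].
intros n; apply picard_0.
Qed.

Lemma picard_lipschitz u0 n i a b :
  Rabs (picard u0 n i b - picard u0 n i a) <= 2 * Rabs (b - a).
Proof.
destruct n as [|n].
- simpl; rewrite Rminus_diag, Rabs_R0; pose proof (Rabs_pos (b - a)); lra.
- apply (lipschitz_of_derive_bound (picard u0 (S n) i) (fun t => field3 (fun j => picard u0 n j t) i)).
  + apply picard_derive.
  + intros t; apply field3_bound.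
Qed.

Lemma lipschitz_continuous (f : R -> R) (M : R) :
  (forall a b, Rabs (f b - f a) <= M * Rabs (b - a)) -> forall t, continuous f t.
Proof.
intros H t.
apply continuity_pt_filterlim; intros e He.
assert (HM : 0 <= M).
{ specialize (H 0 1); rewrite Rminus_0_r, Rabs_R1 in H; pose proof (Rabs_pos (f 1 - f 0)); lra. }
exists (e / (M + 1)); split; [apply Rdiv_lt_0_compat; lra |].
intros x [_ Hx]; simpl in *; unfold Rdist in *.
eapply Rle_lt_trans; [apply H |].
apply Rle_lt_trans with ((M + 1) * Rabs (x - t)).
- pose proof (Rabs_pos (x - t)); nra.
- apply (Rmult_lt_compat_l (M + 1)) in Hx; [|lra].
  replace ((M + 1) * (e / (M + 1))) with e in Hx by (field; lra); exact Hx.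
Qed.

Lemma flow_continuous u0 i t : continuous (flow u0 i) t.
Proof.
apply (lipschitz_continuous _ 2); intros a b.
apply (is_lim_seq_le (fun n => Rabs (picard u0 n i b - picard u0 n i a))
  (fun _ => 2 * Rabs (b - a)) (Rabs (flow u0 i b - flow u0 i a)) (2 * Rabs (b - a))).
- intros n; apply picard_lipschitz.
- apply (is_lim_seq_abs _ (Finite (flow u0 i b - flow u0 i a))).
  apply is_lim_seq_minus'; apply picard_cv.
- apply is_lim_seq_const.
Qed.

Lemma flow_solution u0 : solution (flow u0).
Proof.
set (y := fun i t => u0 i + RInt (fun s => field3 (fun j => flow u0 j s) i) 0 t).
assert (Hy : forall i t, is_derive (y i) t (field3 (fun j => flow u0 j t) i)).
{ intros i t; apply (is_derive_field_primitive (flow u0)), flow_continuous. }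
assert (E : forall i t, flow u0 i t = y i t).
{ intros i t.
  apply Rminus_diag_uniq.
  assert (B : forall n, Rabs (flow u0 i t - y i t) <= 2 * weight t * (1/2) ^ n).
  { intros n.
    assert (Hp : 0 < (1/2) ^ n) by (apply pow_lt; lra).
    assert (B1 : Rabs (picard u0 (S n) i t - y i t) <= 4 * (1/2) ^ n / 4 * weight t).
    { apply (bound_from_derivative (fun t => picard u0 (S n) i t - y i t)
        (fun t => field3 (fun j => picard u0 n j t) i - field3 (fun j => flow u0 j t) i)).
      - intros x; apply (is_derive_minus (picard u0 (S n) i)); [apply picard_derive | apply Hy].
      - rewrite picard_0; unfold y; rewrite RInt_point; unfold zero; simpl; ring.
      - lra.
      - intros x; eapply Rle_trans; [apply field3_lipschitz |].
        pose proof (picard_flow u0 n (prv i) x) as P1; pose proof (picard_flow u0 n (nxt i) x) as P2.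
        rewrite Rabs_minus_sym in P1; rewrite Rabs_minus_sym in P2; lra. }
    pose proof (picard_flow u0 (S n) i t) as B2.
    replace ((1/2) ^ S n) with ((1/2)^n / 2) in B2 by (simpl; field).
    apply Rabs_le_between in B1; apply Rabs_le_between in B2.
    apply Rabs_le; lra. }
  destruct (Req_dec (flow u0 i t - y i t) 0) as [Z | NZ]; [exact Z | exfalso].
  destruct (geometric_small (2 * weight t) _ (Rabs_pos_lt _ NZ)) as [N HN].
  specialize (B N); lra. }
intros i t.
apply (is_derive_ext (y i)); [intros x; symmetry; apply E | apply Hy].
Qed.

(** * Reversing symmetries *)

(** The map [(x, y, z) -> (2 m - x, PI / 2 - z, PI / 2 - y)] reverses the flow when reflection of an
    angle in [m] exchanges sine and cosine.  A solution that meets its fixed line at time [a] is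
    therefore mapped to itself by reversal of time about [a]. *)
Lemma solution_reflection (u : axis -> R -> R) (a m : R) :
  solution u -> u ax a = m -> u ay a + u az a = PI / 2 ->
  (forall w, sin (2 * m - w) = cos w) -> (forall w, cos (2 * m - w) = sin w) ->
  forall t, u ax (2 * a - t) = 2 * m - u ax t /\
    u ay (2 * a - t) = PI / 2 - u az t /\ u az (2 * a - t) = PI / 2 - u ay t.
Proof.
intros Su Hm Hs Sm Cm t.
set (v := fun i s => match i with
  | ax => 2 * m - u ax (2 * a - s)
  | ay => PI / 2 - u az (2 * a - s)
  | az => PI / 2 - u ay (2 * a - s) end).
assert (Sv : solution v).
{ assert (D : forall k i s, is_derive (fun s => k - u i (2 * a - s)) s
    (field3 (fun j => u j (2 * a - s)) i)).
  { intros k i s; evar_last.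
    - apply (is_derive_minus (fun _ => k)); [apply is_derive_const |].
      apply (is_derive_comp (u i) (fun s => 2 * a - s)); [apply Su |].
      auto_derive; [exact I | reflexivity].
    - unfold minus, plus, opp, zero, scal; simpl; unfold mult; simpl; ring. }
  intros [] s; (evar_last; [apply D |]); unfold field3, v; simpl;
    rewrite ?Sm, ?Cm, ?sin_shift, ?cos_shift; ring. }
assert (E : forall i s, u i s = v i s).
{ apply (solution_unique u v a Su Sv); intros []; unfold v;
    replace (2 * a - a) with a by ring; lra. }
pose proof (E ax (2 * a - t)) as E1; pose proof (E ay (2 * a - t)) as E2;
  pose proof (E az (2 * a - t)) as E3; unfold v in E1, E2, E3.
replace (2 * a - (2 * a - t)) with t in E1, E2, E3 by ring.
auto.
Qed.

(** Two reflections, at times 0 and [T] and about lines [2 PI] apart in [x], compose to a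
    translation by [2 T] in time and [4 PI] in [x]. *)
Lemma symmetric_arc_periodic (u : axis -> R -> R) (T : R) :
  solution u ->
  u ax 0 = PI / 4 -> u ay 0 + u az 0 = PI / 2 ->
  u ax T = PI / 4 + 2 * PI -> u ay T + u az T = PI / 2 ->
  forall t, u ax (t + 2 * T) = u ax t + 4 * PI /\
    u ay (t + 2 * T) = u ay t /\ u az (t + 2 * T) = u az t.
Proof.
intros Su X0 S0 XT ST t.
assert (Q : forall w, 2 * (PI / 4) - w = PI / 2 - w) by (intros; field).
assert (Q' : forall w, 2 * (PI / 4 + 2 * PI) - w = PI / 2 - w + 2 * INR 2 * PI)
  by (intros; simpl; field).
destruct (solution_reflection u 0 (PI / 4) Su X0 S0
  ltac:(intros w; rewrite Q; apply sin_shift) ltac:(intros w; rewrite Q; apply cos_shift) t)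
  as (R1 & R2 & R3).
destruct (solution_reflection u T (PI / 4 + 2 * PI) Su XT ST
  ltac:(intros w; rewrite Q', sin_period; apply sin_shift)
  ltac:(intros w; rewrite Q', cos_period; apply cos_shift) (2 * 0 - t)) as (P1 & P2 & P3).
replace (2 * T - (2 * 0 - t)) with (t + 2 * T) in P1, P2, P3 by ring.
rewrite P1, P2, P3, R1, R2, R3; repeat split; field.
Qed.

(** * Validated integration *)

(** ** Polynomials with integer coefficients *)

(** Constant coefficient first. *)
Definition poly := list Z.

Fixpoint padd (p q : poly) : poly :=
  match p, q with
  | [], _ => q
  | _, [] => p
  | a :: p', b :: q' => (a + b)%Z :: padd p' q'
  end.
Definition pscale (k : Z) (p : poly) : poly := map (Z.mul k) p.
Fixpoint pmul (p q : poly) : poly :=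
  match p with
  | [] => []
  | a :: p' => padd (pscale a q) (0%Z :: pmul p' q)
  end.
Fixpoint pder_from (k : Z) (p : poly) : poly :=
  match p with
  | [] => []
  | a :: p' => (k * a)%Z :: pder_from (k + 1) p'
  end.
Definition pder (p : poly) : poly := pder_from 1 (tl p).
(** Sum of the absolute values of the coefficients: a bound on the unit interval. *)
Definition pnorm (p : poly) : Z := fold_right (fun a s => (Z.abs a + s)%Z) 0%Z p.
(** The value at 1. *)
Definition psum (p : poly) : Z := fold_right Z.add 0%Z p.

Fixpoint peval (p : poly) (t : R) : R :=
  match p with
  | [] => 0
  | a :: p' => IZR a + t * peval p' t
  end.

Lemma peval_add p q t : peval (padd p q) t = peval p t + peval q t.
Proof.
revert q; induction p as [|a p IH]; intros [|b q]; simpl; try ring.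
rewrite IH, plus_IZR; ring.
Qed.

Lemma peval_scale k p t : peval (pscale k p) t = IZR k * peval p t.
Proof.
induction p as [|a p IH]; simpl; [ring |].
rewrite IH, mult_IZR; ring.
Qed.

Lemma peval_mul p q t : peval (pmul p q) t = peval p t * peval q t.
Proof.
induction p as [|a p IH]; simpl; [ring |].
rewrite peval_add, peval_scale; simpl; rewrite IH; ring.
Qed.

Lemma peval_0 p : peval p 0 = IZR (hd 0%Z p).
Proof. destruct p; simpl; ring. Qed.

Lemma peval_1 p : peval p 1 = IZR (psum p).
Proof.
induction p as [|a p IH]; simpl; [reflexivity |].
rewrite IH, plus_IZR; ring.
Qed.

Lemma peval_norm p t : 0 <= t <= 1 -> Rabs (peval p t) <= IZR (pnorm p).
Proof.
intros Ht; induction p as [|a p IH]; simpl; [rewrite Rabs_R0; lra |].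
rewrite plus_IZR, abs_IZR.
eapply Rle_trans; [apply Rabs_triang |].
apply Rplus_le_compat_l; rewrite Rabs_mult, (Rabs_pos_eq t) by lra.
pose proof (Rabs_pos (peval p t)); nra.
Qed.

Lemma is_derive_peval_from k p t :
  is_derive (fun t => peval p t * t ^ S k) t (peval (pder_from (Z.of_nat (S k)) p) t * t ^ k).
Proof.
revert k; induction p as [|a p IH]; intros k; cbn [peval pder_from].
- rewrite Rmult_0_l; apply (is_derive_ext (fun _ : R => 0)); [intros x; simpl; ring |].
  apply (is_derive_const 0).
- apply (is_derive_ext (fun t => IZR a * t ^ S k + peval p t * t ^ S (S k))).
  { intros x; simpl; ring. }
  evar_last.
  + apply (is_derive_plus (fun t => IZR a * t ^ S k)); [|apply IH].
    auto_derive; [exact I | reflexivity].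
  + unfold plus; cbn -[pow INR Z.of_nat].
    replace (Z.of_nat (S k) + 1)%Z with (Z.of_nat (S (S k))) by lia.
    rewrite mult_IZR, <- INR_IZR_INZ; cbn [pred]; rewrite <- tech_pow_Rmult.
    change (match k with O => 1 | S _ => INR k + 1 end) with (INR (S k)).
    match goal with |- ?x = ?y => change (@eq R x y) end; ring.
Qed.

Lemma is_derive_peval p t : is_derive (peval p) t (peval (pder p) t).
Proof.
destruct p as [|a p]; unfold pder; simpl.
- apply (is_derive_const 0).
- apply (is_derive_ext (fun t => IZR a + peval p t * t ^ 1)); [intros; simpl; ring |].
  evar_last.
  + apply (is_derive_plus (fun _ => IZR a)); [apply is_derive_const |].
    apply (is_derive_peval_from 0).
  + rewrite plus_zero_l; simpl; ring.
Qed.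

(** ** Fixed-point data *)

(** For one axis: the displacement from the initial value, and approximations of the cosine and
    the sine of the coordinate. *)
Record trip (T : Type) : Type := Trip { disp : T; cosp : T; sinp : T }.
Arguments Trip {T}. Arguments disp {T}. Arguments cosp {T}. Arguments sinp {T}.
Record vec3 (T : Type) : Type := Vec3 { vx : T; vy : T; vz : T }.
Arguments Vec3 {T}. Arguments vx {T}. Arguments vy {T}. Arguments vz {T}.
Definition at_axis {T} (v : vec3 T) (i : axis) : T :=
  match i with ax => vx v | ay => vy v | az => vz v end.
Definition map_trip {T U} (f : T -> U) (x : trip T) : trip U :=
  Trip (f (disp x)) (f (cosp x)) (f (sinp x)).
Definition map_vec3 {T U} (f : T -> U) (v : vec3 T) : vec3 U :=
  Vec3 (f (vx v)) (f (vy v)) (f (vz v)).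

Definition state := vec3 (trip Z).
Definition arc := vec3 (trip poly).

(** Real numbers are represented by integers, in units of [2 ^ -66]. *)
Definition unit_bits : Z := 66.
Definition one_fp : Z := (2 ^ unit_bits)%Z.
(** The accepted residual [2 ^ -56], at the scale of a product of two fixed-point numbers. *)
Definition tol : Z := (2 ^ (2 * unit_bits - 56))%Z.
Definition fp (n : Z) : R := IZR n / IZR one_fp.

Definition small (p : poly) : bool := (pnorm p <=? tol)%Z.

(** Over one step of length [fp h], traversed in unit time, [P] starts from [q] and its residuals
    in the sense of [tracking] are at most [2 ^ -56]. *)
Definition check_axis (h : Z) (q : state) (P : arc) (i : axis) : bool :=
  let A := at_axis P i in
  let d := pder (disp A) in
  ((hd 0 (disp A) =? disp (at_axis q i))%Z &&
   (hd 0 (cosp A) =? cosp (at_axis q i))%Z &&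
   (hd 0 (sinp A) =? sinp (at_axis q i))%Z &&
   small (padd (pscale one_fp d)
      (pscale (- h) (padd (sinp (at_axis P (prv i))) (cosp (at_axis P (nxt i)))))) &&
   small (padd (pscale one_fp (pder (cosp A))) (pmul (sinp A) d)) &&
   small (padd (pscale one_fp (pder (sinp A))) (pscale (-1) (pmul (cosp A) d))))%bool.

Definition check_arc (h : Z) (q : state) (P : arc) : bool :=
  (check_axis h q P ax && check_axis h q P ay && check_axis h q P az)%bool.

(** ** Taylor coefficients *)

(** No property of the functions that compute Taylor polynomials is needed, since [check_arc]
    validates their output. *)
Fixpoint dot (p q : poly) : Z :=
  match p, q with
  | a :: p', b :: q' => (a * b + dot p' q')%Z
  | _, _ => 0%Z
  end.

(** Truncated series, highest coefficient first, with the coefficients of the derivative of the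
    displacement, lowest first, so that [dot] computes a coefficient of a product. *)
Definition growing := (trip poly * poly)%type.

(** Appends the coefficients of index [k], given the coefficient [d] of index [k - 1] of the
    derivative of the displacement. *)
Definition extend (k d : Z) (G : growing) : growing :=
  let (A, ds) := G in
  let ds' := ds ++ [d] in
  (Trip ((d / k)%Z :: disp A)
        ((- dot (sinp A) ds' / (one_fp * k))%Z :: cosp A)
        ((dot (cosp A) ds' / (one_fp * k))%Z :: sinp A), ds').

Fixpoint taylor (n : nat) (h k : Z) (G : vec3 growing) : vec3 growing :=
  match n with
  | O => G
  | S m =>
    let c i := hd 0%Z (cosp (fst (at_axis G i))) in
    let s i := hd 0%Z (sinp (fst (at_axis G i))) in
    let d i := (h * (s (prv i) + c (nxt i)) / one_fp)%Z in
    taylor m h (k + 1)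
      (Vec3 (extend k (d ax) (vx G)) (extend k (d ay) (vy G)) (extend k (d az) (vz G)))
  end.

Definition taylor_arc (n : nat) (h : Z) (q : state) : arc :=
  map_vec3 (fun G => map_trip (@rev Z) (fst G))
    (taylor n h 1 (map_vec3 (fun x => (map_trip (fun a => [a]) x, [])) q)).

(** [N] validated steps of order [n]; the next step starts from the exact value at 1 of the current
    polynomials, so that no error arises between steps. *)
Fixpoint integrate (N n : nat) (h : Z) (q : state) : option state :=
  match N with
  | O => Some q
  | S M =>
    let P := taylor_arc n h q in
    if check_arc h q P then integrate M n h (map_vec3 (map_trip psum) P) else None
  end.

(** ** Soundness *)

(** The functional [gap] for a fixed-point state; displacements are counted from [o]. *)
Definition state_gap (o : axis -> R) (q : state) (u : axis -> R -> R) (t : R) : R :=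
  sum3 (fun i => mismatch (u i t) (o i + fp (disp (at_axis q i)))
    (fp (cosp (at_axis q i))) (fp (sinp (at_axis q i)))).

Lemma one_fp_pos : 0 < IZR one_fp.
Proof. apply IZR_lt; reflexivity. Qed.

Lemma small_bound p t : small p = true -> 0 <= t <= 1 ->
  Rabs (peval p t / IZR one_fp ^ 2) <= / 2 ^ 56.
Proof.
intros Hs Ht; unfold small in Hs; apply Z.leb_le, IZR_le in Hs.
pose proof (peval_norm p t Ht) as Hn.
pose proof one_fp_pos as H1.
unfold Rdiv; rewrite Rabs_mult, (Rabs_pos_eq (/ _)) by (left; apply Rinv_0_lt_compat, pow_lt; lra).
apply (Rmult_le_reg_r (IZR one_fp ^ 2)); [apply pow_lt; lra |].
rewrite Rmult_assoc, Rinv_l, Rmult_1_r by (apply pow_nonzero; lra).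
apply Rle_trans with (IZR tol); [lra |].
apply Req_le; unfold tol, one_fp, unit_bits.
change (2 * 66 - 56)%Z with 76%Z.
change (2 ^ 66)%Z with (2 ^ Z.of_nat 66)%Z; change (2 ^ 76)%Z with (2 ^ Z.of_nat 76)%Z.
rewrite <- !pow_IZR; simpl IZR.
apply (Rmult_eq_reg_l (2 ^ 56)); [|apply pow_nonzero; lra].
rewrite <- Rmult_assoc, Rinv_r, Rmult_1_l by (apply pow_nonzero; lra).
rewrite <- pow_mult, <- pow_add; reflexivity.
Qed.

Lemma check_arc_axis h q P i : check_arc h q P = true -> check_axis h q P i = true.
Proof.
unfold check_arc; rewrite !andb_true_iff; intros [[H1 H2] H3]; destruct i; assumption.
Qed.

Lemma is_derive_fp_poly p t :
  is_derive (fun t => peval p t / IZR one_fp) t (peval (pder p) t / IZR one_fp).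
Proof.
apply (is_derive_ext (fun t => / IZR one_fp * peval p t)); [intros; apply Rmult_comm |].
unfold Rdiv; rewrite Rmult_comm; apply (is_derive_scal (peval p)), is_derive_peval.
Qed.

Lemma check_arc_sound (o : axis -> R) (h : Z) (q : state) (P : arc)
    (u : axis -> R -> R) (t0 : R) :
  (0 < h)%Z -> solution u -> check_arc h q P = true ->
  state_gap o (map_vec3 (map_trip psum) P) u (t0 + fp h)
    <= exp (9 / 2 * fp h) * (state_gap o q u t0 + 60 * (/ 2 ^ 56) ^ 2 / fp h).
Proof.
intros Hh Su HC.
pose proof one_fp_pos as H1.
assert (Hk : 0 < fp h) by (apply Rdiv_lt_0_compat; [apply IZR_lt; exact Hh | exact H1]).
set (ev := fun p t => peval p t / IZR one_fp).
set (v := fun i t => o i + ev (disp (at_axis P i)) t).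
set (c := fun i => ev (cosp (at_axis P i))).
set (s := fun i => ev (sinp (at_axis P i))).
assert (K : forall i, check_axis h q P i = true) by (intros; apply check_arc_axis; exact HC).
clear HC; unfold check_axis in K.
assert (E0 : gap (fun i t => u i (t0 + fp h * t)) v c s 0 = state_gap o q u t0).
{ unfold gap, state_gap; rewrite Rmult_0_r, Rplus_0_r.
  assert (forall i, v i 0 = o i + fp (disp (at_axis q i)) /\ c i 0 = fp (cosp (at_axis q i))
    /\ s i 0 = fp (sinp (at_axis q i))) as F.
  { intros i; specialize (K i); rewrite !andb_true_iff in K.
    destruct K as (((((K1 & K2) & K3) & _) & _) & _).
    apply Z.eqb_eq in K1; apply Z.eqb_eq in K2; apply Z.eqb_eq in K3.
    unfold v, c, s, ev, fp; rewrite !peval_0, K1, K2, K3; auto. }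
  unfold sum3; destruct (F ax) as (-> & -> & ->); destruct (F ay) as (-> & -> & ->);
    destruct (F az) as (-> & -> & ->); reflexivity. }
assert (E1 : gap (fun i t => u i (t0 + fp h * t)) v c s 1
  = state_gap o (map_vec3 (map_trip psum) P) u (t0 + fp h)).
{ unfold gap, state_gap; rewrite Rmult_1_r.
  assert (forall i, v i 1 = o i + fp (disp (at_axis (map_vec3 (map_trip psum) P) i))
    /\ c i 1 = fp (cosp (at_axis (map_vec3 (map_trip psum) P) i))
    /\ s i 1 = fp (sinp (at_axis (map_vec3 (map_trip psum) P) i))) as F.
  { intros i; unfold v, c, s, ev, fp; rewrite !peval_1; destruct i; auto. }
  unfold sum3; destruct (F ax) as (-> & -> & ->); destruct (F ay) as (-> & -> & ->);
    destruct (F az) as (-> & -> & ->); reflexivity. }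
rewrite <- E0, <- E1.
apply (tracking (fun i t => u i (t0 + fp h * t)) v c s
  (fun i => ev (pder (disp (at_axis P i)))) (fun i => ev (pder (cosp (at_axis P i))))
  (fun i => ev (pder (sinp (at_axis P i)))) (fp h) (fp h) (/ 2 ^ 56)).
- exact Hk.
- rewrite Rabs_pos_eq; lra.
- intros i t _; evar_last.
  + apply (is_derive_comp (u i) (fun t => t0 + fp h * t)); [apply Su |].
    auto_derive; [exact I | reflexivity].
  + rewrite Rmult_1_r; reflexivity.
- intros i t _; unfold v; evar_last.
  + apply (is_derive_plus (fun _ => o i)); [apply is_derive_const | apply is_derive_fp_poly].
  + apply plus_zero_l.
- intros i t _; apply is_derive_fp_poly.
- intros i t _; apply is_derive_fp_poly.
- intros i t Ht; specialize (K i); rewrite !andb_true_iff in K.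
  destruct K as (((_ & K) & _) & _).
  eapply Rle_trans; [right | exact (small_bound _ t K Ht)]; f_equal.
  rewrite peval_add, !peval_scale, peval_add, opp_IZR; unfold s, c, ev, fp; field; lra.
- intros i t Ht; specialize (K i); rewrite !andb_true_iff in K.
  destruct K as ((_ & K) & _).
  eapply Rle_trans; [right | exact (small_bound _ t K Ht)]; f_equal.
  rewrite peval_add, peval_scale, peval_mul; unfold s, ev; field; lra.
- intros i t Ht; specialize (K i); rewrite !andb_true_iff in K.
  destruct K as (_ & K).
  eapply Rle_trans; [right | exact (small_bound _ t K Ht)]; f_equal.
  rewrite peval_add, !peval_scale, peval_mul; unfold c, ev; field; lra.
Qed.

Lemma integrate_sound (o : axis -> R) (N n : nat) (h : Z) (q q' : state)
    (u : axis -> R -> R) (t0 : R) :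
  (0 < h)%Z -> solution u -> integrate N n h q = Some q' ->
  state_gap o q' u (t0 + INR N * fp h)
    <= exp (9 / 2 * (INR N * fp h))
       * (state_gap o q u t0 + INR N * (60 * (/ 2 ^ 56) ^ 2 / fp h)).
Proof.
intros Hh Su.
assert (Hk : 0 < fp h) by (apply Rdiv_lt_0_compat; [apply IZR_lt; exact Hh | exact one_fp_pos]).
set (w := 60 * (/ 2 ^ 56) ^ 2 / fp h).
assert (Hw : 0 <= w).
{ apply Rmult_le_pos; [|left; apply Rinv_0_lt_compat; exact Hk].
  pose proof (pow2_ge_0 (/ 2 ^ 56)); lra. }
revert q t0; induction N as [|N IH]; intros q t0 HI.
- injection HI as <-; simpl; rewrite Rmult_0_l, !Rmult_0_r, Rplus_0_r, exp_0; lra.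
- cbn [integrate] in HI.
  destruct (check_arc h q (taylor_arc n h q)) eqn:HC; [|discriminate].
  pose proof (check_arc_sound o h q _ u t0 Hh Su HC) as H1; fold w in H1.
  specialize (IH _ (t0 + fp h) HI).
  rewrite S_INR; replace (t0 + (INR N + 1) * fp h) with (t0 + fp h + INR N * fp h) by ring.
  eapply Rle_trans; [exact IH |].
  replace (9 / 2 * ((INR N + 1) * fp h)) with (9 / 2 * (INR N * fp h) + 9 / 2 * fp h) by ring.
  rewrite exp_plus, Rmult_assoc; apply Rmult_le_compat_l; [left; apply exp_pos |].
  assert (1 <= exp (9 / 2 * fp h)) by (rewrite <- exp_0; apply exp_le_exp; lra).
  assert (0 <= INR N * w) by (apply Rmult_le_pos; [apply pos_INR | exact Hw]).
  nra.
Qed.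

(** * Numerical constants *)

Lemma PI_bounds : 3.1415926535897 <= PI <= 3.1415926535899.
Proof.
pose proof (PI_2_3_7_ineq 6) as [H1 H2].
simpl (2 * 6)%nat in H1, H2.
cbn [sum_f_R0] in H1, H2.
unfold tg_alt, PI_2_3_7_tg, Ratan_seq in H1, H2.
cbn [Nat.mul Nat.add] in H1, H2.
rewrite !INR_IZR_INZ in H1; rewrite !INR_IZR_INZ in H2.
cbn [Z.of_nat Pos.of_succ_nat Pos.succ] in H1, H2.
cbn [pow] in H1, H2.
split; lra.
Qed.

(** Since [4.5 * 3.8988329 <= 1024 * 0.01713379], ten squarings of a bound for
    [exp 0.01713379] suffice. *)
Lemma exp_bound (k : R) : k <= 3.8988329 -> exp (9 / 2 * k) <= 7100 ^ 2.
Proof.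
intros Hk.
apply Rle_trans with (exp (1024 * 0.01713379)); [apply exp_le_exp; lra |].
assert (H : exp 0.01713379 <= 1.01743248).
{ assert (Q : forall y, exp y * (1 - y) <= 1).
  { intros y; pose proof (exp_ineq1_le (- y)) as H; rewrite exp_Ropp in H.
    pose proof (exp_pos y) as Hp.
    apply (Rmult_le_compat_l (exp y)) in H; [|lra].
    rewrite Rinv_r in H by lra; lra. }
  specialize (Q 0.01713379); lra. }
assert (Sq : forall x a b, exp x <= a -> a * a <= b -> exp (2 * x) <= b).
{ intros x a b H1 H2; replace (2 * x) with (x + x) by ring; rewrite exp_plus.
  pose proof (exp_pos x); nra. }
replace (1024 * 0.01713379) with
  (2 * (2 * (2 * (2 * (2 * (2 * (2 * (2 * (2 * (2 * 0.01713379)))))))))) by field.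
eapply Sq; [eapply Sq; [eapply Sq; [eapply Sq; [eapply Sq; [eapply Sq; [eapply Sq;
  [eapply Sq; [eapply Sq; [eapply Sq; [exact H |] |] |] |] |] |] |] |] |] |].
- instantiate (1 := 1.0351689); lra.
- instantiate (1 := 1.0715747); lra.
- instantiate (1 := 1.1482724); lra.
- instantiate (1 := 1.3185296); lra.
- instantiate (1 := 1.7385204); lra.
- instantiate (1 := 3.0224532); lra.
- instantiate (1 := 9.1352234); lra.
- instantiate (1 := 83.452307); lra.
- instantiate (1 := 6964.2876); lra.
- lra.
Qed.


(** * Shooting *)

(** For [s] in [[a, b]] the function [x s] increases at rate at least [m], and reaches [c] at a unique
    time in [[t1, t2]], which depends continuously on [s].  The value of [g s] at this time is
    nonnegative for [s = a] and nonpositive for [s = b], so it vanishes somewhere. *)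
Lemma shooting (x g : R -> R -> R) (a b t1 t2 c m M L : R) :
  a <= b -> t1 <= t2 -> 0 < m -> 0 <= M -> 0 <= L ->
  (forall s t t', a <= s <= b -> t1 <= t -> t <= t' -> t' <= t2 ->
     m * (t' - t) <= x s t' - x s t) ->
  (forall s t, continuous (x s) t) ->
  (forall s s' t, a <= s <= b -> a <= s' <= b -> t1 <= t <= t2 ->
     Rabs (x s t - x s' t) <= L * Rabs (s - s')) ->
  (forall s s' t, a <= s <= b -> a <= s' <= b -> t1 <= t <= t2 ->
     Rabs (g s t - g s' t) <= L * Rabs (s - s')) ->
  (forall s t t', Rabs (g s t - g s t') <= M * Rabs (t - t')) ->
  (forall s, a <= s <= b -> x s t1 <= c <= x s t2) ->
  (forall t, t1 <= t <= t2 -> x a t = c -> 0 <= g a t) ->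
  (forall t, t1 <= t <= t2 -> x b t = c -> g b t <= 0) ->
  exists s t, a <= s <= b /\ t1 <= t <= t2 /\ x s t = c /\ g s t = 0.
Proof.
intros Hab H12 Hm HM HL Mono Cx Lx Lg Lt Cr Pa Pb.
(* The parameter is clamped to [a, b] to obtain functions on the whole line. *)
set (k := fun s => Rmax a (Rmin s b)).
assert (Kr : forall s, a <= k s <= b).
{ intros s; unfold k, Rmax, Rmin; repeat destruct Rle_dec; lra. }
assert (Kl : forall s s', Rabs (k s' - k s) <= Rabs (s' - s)).
{ intros s s'; unfold k, Rmax, Rmin, Rabs; repeat destruct Rle_dec; repeat destruct Rcase_abs; lra. }
(* The hitting time, and its Lipschitz dependence on the parameter. *)
assert (T : forall s, {t | t1 <= t <= t2 /\ x (k s) t = c}).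
{ intros s; destruct (IVT_gen (x (k s)) t1 t2 c) as [t [Ht E]].
  - intros t; apply continuity_pt_filterlim, Cx.
  - destruct (Cr (k s) (Kr s)); rewrite Rmin_left, Rmax_right by lra; lra.
  - exists t; rewrite Rmin_left, Rmax_right in Ht by lra; auto. }
set (tau := fun s => proj1_sig (T s)).
assert (Tr : forall s, t1 <= tau s <= t2) by (intros s; apply (proj2_sig (T s))).
assert (Te : forall s, x (k s) (tau s) = c) by (intros s; apply (proj2_sig (T s))).
clearbody tau.
assert (Tl : forall s s', Rabs (tau s' - tau s) <= L / m * Rabs (k s' - k s)).
{ intros s s'.
  assert (E : m * Rabs (tau s' - tau s) <= Rabs (x (k s') (tau s') - x (k s') (tau s))).
  { pose proof (Tr s); pose proof (Tr s').
    destruct (Rle_dec (tau s) (tau s')) as [Q | Q].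
    - pose proof (Mono (k s') (tau s) (tau s') (Kr s') ltac:(lra) Q ltac:(lra)).
      rewrite (Rabs_pos_eq (tau s' - tau s)) by lra.
      eapply Rle_trans; [eassumption | apply Rle_abs].
    - pose proof (Mono (k s') (tau s') (tau s) (Kr s') ltac:(lra) ltac:(lra) ltac:(lra)).
      rewrite Rabs_minus_sym, (Rabs_pos_eq (tau s - tau s')), Rabs_minus_sym by lra.
      eapply Rle_trans; [eassumption | apply Rle_abs]. }
  rewrite Te, <- (Te s) in E.
  pose proof (Lx (k s) (k s') (tau s) (Kr s) (Kr s') (Tr s)) as E2.
  rewrite (Rabs_minus_sym (k s)) in E2.
  apply (Rmult_le_reg_l m); [exact Hm |].
  replace (m * (L / m * Rabs (k s' - k s))) with (L * Rabs (k s' - k s)) by (field; lra); lra. }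
set (G := fun s => g (k s) (tau s)).
assert (Gl : forall s s', Rabs (G s' - G s) <= (L + M * (L / m)) * Rabs (s' - s)).
{ intros s s'; unfold G.
  replace (g (k s') (tau s') - g (k s) (tau s)) with
    ((g (k s') (tau s') - g (k s) (tau s')) + (g (k s) (tau s') - g (k s) (tau s))) by ring.
  eapply Rle_trans; [apply Rabs_triang |].
  pose proof (Lg (k s') (k s) (tau s') (Kr s') (Kr s) (Tr s')) as E1.
  pose proof (Lt (k s) (tau s') (tau s)) as E2.
  specialize (Tl s s').
  assert (E3 : M * Rabs (tau s' - tau s) <= M * (L / m * Rabs (k s' - k s)))
    by (apply Rmult_le_compat_l; assumption).
  assert (E4 : (L + M * (L / m)) * Rabs (k s' - k s) <= (L + M * (L / m)) * Rabs (s' - s)).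
  { apply Rmult_le_compat_l; [|apply Kl].
    assert (0 <= L / m) by (apply Rmult_le_pos; [lra | left; apply Rinv_0_lt_compat; lra]); nra. }
  lra. }
destruct (IVT_gen G a b 0) as [s [Hs E]].
- intros s; apply continuity_pt_filterlim, (lipschitz_continuous G _ Gl).
- assert (Ka : k a = a) by (unfold k, Rmax, Rmin; repeat destruct Rle_dec; lra).
  assert (Kb : k b = b) by (unfold k, Rmax, Rmin; repeat destruct Rle_dec; lra).
  assert (Ga : 0 <= G a).
  { unfold G; rewrite Ka; apply Pa; [apply Tr | rewrite <- Ka at 1; apply Te]. }
  assert (Gb : G b <= 0).
  { unfold G; rewrite Kb; apply Pb; [apply Tr | rewrite <- Kb at 1; apply Te]. }
  split; [eapply Rle_trans; [apply Rmin_r | exact Gb] | eapply Rle_trans; [exact Ga | apply Rmax_l]].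
- exists (k s), (tau s); auto.
Qed.

(** * The family of trajectories that start on a symmetry line *)

(** A parametrization of the line [x = PI / 4], [y + z = PI / 2]. *)
Definition start (a : R) (i : axis) : R :=
  match i with ax => PI / 4 | ay => a | az => PI / 2 - a end.

(** The trajectory that starts at the point of parameter [a]. *)
Definition launch (a : R) : axis -> R -> R := flow (start a).

Lemma launch_solution a : solution (launch a).
Proof. apply flow_solution. Qed.

Lemma launch_0 a i : launch a i 0 = start a i.
Proof. apply flow_0. Qed.

(** [10650 = 7100 * 3 / 2], where 7100 bounds the growth up to the time 3.8988329, and [3 / 2] bounds
    the distance [sqrt 2] of the starting points of parameters 0 and 1. *)
Lemma launch_dependence (a b : R) (i : axis) (t : R) :
  0 <= t <= 3.8988329 -> Rabs (launch a i t - launch b i t) <= 10650 * Rabs (a - b).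
Proof.
intros Ht.
replace (10650 * Rabs (a - b)) with (7100 * (3 / 2 * Rabs (a - b))) by field.
pose proof (Rabs_pos (a - b)).
rewrite <- (Rplus_0_l t).
apply (solution_dependence _ _ i 0 0 t 3.8988329); try lra; try apply launch_solution.
- rewrite Rabs_pos_eq; lra.
- apply exp_bound; lra.
- unfold sum3; rewrite !launch_0; unfold start.
  rewrite Rpow_mult_distr, pow2_abs; pose proof (pow2_ge_0 (a - b)); lra.
Qed.

Lemma launch_time_lipschitz (a : R) (i : axis) (t t' : R) :
  Rabs (launch a i t' - launch a i t) <= 2 * Rabs (t' - t).
Proof.
apply (lipschitz_of_derive_bound _ (fun t => field3 (fun j => launch a j t) i)).
- apply launch_solution.
- intros s; apply field3_bound.
Qed.


(** * The computation *)

(** ** Starting states *)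

Definition denom : Z := (10 ^ 12)%Z.

(** Parameters of the form [2 atan (r / 10 ^ 12)] have rational sine and cosine. *)
Definition start_angle (r : Z) : R := 2 * atan (IZR r / IZR denom).

Definition start_state (r : Z) : state :=
  let k := Z.sqrt (one_fp * one_fp / 2) in
  let n := (denom * denom + r * r)%Z in
  let c := ((denom * denom - r * r) * one_fp / n)%Z in
  let s := (2 * r * denom * one_fp / n)%Z in
  Vec3 (Trip 0 k k)%Z (Trip 0 c s)%Z (Trip 0 s c)%Z.

Lemma fp_div (a b : Z) : (0 < b)%Z ->
  Rabs (fp (a * one_fp / b) - IZR a / IZR b) <= / IZR one_fp.
Proof.
intros Hb; pose proof one_fp_pos as H1; apply IZR_lt in Hb as Hb'.
pose proof (Z.div_mod (a * one_fp) b ltac:(lia)) as E.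
pose proof (Z.mod_pos_bound (a * one_fp) b Hb) as [M0 M1].
set (q := (a * one_fp / b)%Z) in *; set (m := (a * one_fp mod b)%Z) in *.
apply (f_equal IZR) in E; rewrite plus_IZR, !mult_IZR in E.
apply IZR_le in M0; apply IZR_lt in M1.
assert (Ea : IZR a = (IZR b * IZR q + IZR m) / IZR one_fp) by (rewrite <- E; field; lra).
rewrite Ea; unfold fp.
replace (IZR q / IZR one_fp - (IZR b * IZR q + IZR m) / IZR one_fp / IZR b)
  with (- (IZR m / IZR b * / IZR one_fp)) by (field; lra).
assert (Hi : 0 < / IZR one_fp) by (apply Rinv_0_lt_compat; exact H1).
assert (0 <= IZR m / IZR b <= 1).
{ split; [apply Rmult_le_pos; [lra | left; apply Rinv_0_lt_compat; lra] |].
  apply (Rmult_le_reg_r (IZR b)); [lra |]; unfold Rdiv; rewrite Rmult_assoc, Rinv_l; lra. }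
rewrite Rabs_Ropp, Rabs_pos_eq; nra.
Qed.

Lemma fp_sqrt_half : Rabs (fp (Z.sqrt (one_fp * one_fp / 2)) - 1 / sqrt 2) <= / IZR one_fp.
Proof.
pose proof one_fp_pos as H1.
destruct (Z.sqrt_spec (one_fp * one_fp / 2)) as [Q1 Q2]; [vm_compute; discriminate |].
set (k := Z.sqrt (one_fp * one_fp / 2)) in *.
assert (K0 : (0 <= k)%Z) by apply Z.sqrt_nonneg.
assert (Eh : (2 * (one_fp * one_fp / 2) = one_fp * one_fp)%Z) by reflexivity.
set (w := (one_fp * one_fp / 2)%Z) in *; clearbody k w.
apply IZR_le in Q1, K0; apply IZR_lt in Q2; apply (f_equal IZR) in Eh.
rewrite !mult_IZR, ?succ_IZR in *.
assert (Hs : 0 < sqrt 2) by (apply sqrt_lt_R0; lra).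
assert (S2 : sqrt 2 * sqrt 2 = 2) by (apply sqrt_sqrt; lra).
set (z := IZR one_fp / sqrt 2).
assert (Hz : 0 < z) by (apply Rdiv_lt_0_compat; lra).
assert (Ez : z * z = IZR w).
{ unfold z; replace (IZR one_fp / sqrt 2 * (IZR one_fp / sqrt 2))
    with (IZR one_fp * IZR one_fp / (sqrt 2 * sqrt 2)) by (field; lra).
  rewrite S2; lra. }
assert (B : IZR k <= z <= IZR k + 1) by (split; nra).
replace (1 / sqrt 2) with (z * / IZR one_fp) by (unfold z; field; lra).
assert (Hi : 0 < / IZR one_fp) by (apply Rinv_0_lt_compat; exact H1).
unfold fp, Rdiv; rewrite <- Rmult_minus_distr_r, Rabs_mult, (Rabs_pos_eq (/ _)) by lra.
assert (Rabs (IZR k - z) <= 1) by (apply Rabs_le; lra).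
nra.
Qed.

Lemma sin_double_atan x : sin (2 * atan x) = 2 * x / (1 + x * x).
Proof.
assert (H : 0 < 1 + x * x) by nra.
rewrite sin_2a, sin_atan, cos_atan; unfold Rsqr.
pose proof (sqrt_lt_R0 _ H) as Hs; pose proof (sqrt_sqrt (1 + x * x) ltac:(lra)) as E.
set (q := sqrt (1 + x * x)) in *; rewrite <- E; field; lra.
Qed.

Lemma cos_double_atan x : cos (2 * atan x) = (1 - x * x) / (1 + x * x).
Proof.
assert (H : 0 < 1 + x * x) by nra.
rewrite cos_2a, sin_atan, cos_atan; unfold Rsqr.
pose proof (sqrt_lt_R0 _ H) as Hs; pose proof (sqrt_sqrt (1 + x * x) ltac:(lra)) as E.
set (q := sqrt (1 + x * x)) in *; rewrite <- E; field; lra.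
Qed.

Lemma gap_start (r : Z) :
  state_gap (start (start_angle r)) (start_state r) (launch (start_angle r)) 0
    <= 24 * (/ IZR one_fp) ^ 2.
Proof.
assert (Hd : 0 < IZR denom) by (apply IZR_lt; reflexivity).
set (n := (denom * denom + r * r)%Z).
assert (Hn : (0 < n)%Z) by (unfold n; pose proof (eq_refl : (0 <? denom)%Z = true); nia).
apply IZR_lt in Hn as Hn'.
assert (En : IZR n = IZR denom * IZR denom + IZR r * IZR r)
  by (unfold n; rewrite plus_IZR, !mult_IZR; reflexivity).
pose proof (fp_div (denom * denom - r * r) n Hn) as Bc.
pose proof (fp_div (2 * r * denom) n Hn) as Bs.
pose proof fp_sqrt_half as Bk.
rewrite minus_IZR, !mult_IZR in Bc; rewrite !mult_IZR in Bs.
replace ((IZR denom * IZR denom - IZR r * IZR r) / IZR n) with (cos (start_angle r)) in Bc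
  by (unfold start_angle; rewrite cos_double_atan; rewrite En in *; field; split; nra).
replace (2 * IZR r * IZR denom / IZR n) with (sin (start_angle r)) in Bs
  by (unfold start_angle; rewrite sin_double_atan; rewrite En in *; field; split; nra).
fold n in Bc, Bs.
assert (Sq : forall x e, Rabs x <= e -> x ^ 2 <= e ^ 2).
{ intros x e H; rewrite <- (pow2_abs x); apply pow_incr; split; [apply Rabs_pos | exact H]. }
apply Sq in Bc, Bs, Bk.
assert (F0 : fp 0 = 0) by (unfold fp; field; pose proof one_fp_pos; lra).
unfold state_gap, mismatch, sum3; rewrite !launch_0; unfold start, start_state; fold n;
  cbn [at_axis vx vy vz disp cosp sinp].
rewrite F0, !Rplus_0_r, cos_PI4, sin_PI4, cos_shift, sin_shift.
lra.
Qed.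

(** ** Integration over half a period *)

Definition steps : nat := 32.
Definition order : nat := 18.

(** All nine numbers of the state are within [e] of what they represent. *)
Definition near_state (o : axis -> R) (q : state) (u : axis -> R -> R) (t e : R) : Prop :=
  forall i, let v := o i + fp (disp (at_axis q i)) in
    Rabs (u i t - v) <= e /\ Rabs (fp (cosp (at_axis q i)) - cos v) <= e
    /\ Rabs (fp (sinp (at_axis q i)) - sin v) <= e.

Lemma near_of_gap o q u t e :
  0 <= e -> state_gap o q u t <= e ^ 2 -> near_state o q u t e.
Proof.
intros He H i v.
assert (Sq : forall x, x ^ 2 <= e ^ 2 -> Rabs x <= e).
{ intros x Hx; rewrite <- (Rabs_pos_eq e He); apply Rsqr_le_abs_0; rewrite !Rsqr_pow2; exact Hx. }
set (f := fun i => mismatch (u i t) (o i + fp (disp (at_axis q i)))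
  (fp (cosp (at_axis q i))) (fp (sinp (at_axis q i)))).
assert (P : forall i, 0 <= f i) by (intros j; apply mismatch_ge_0).
assert (Fi : f i <= e ^ 2).
{ change (state_gap o q u t) with (sum3 f) in H; unfold sum3 in H.
  pose proof (P ax); pose proof (P ay); pose proof (P az); destruct i; lra. }
destruct (mismatch_ge_squares (u i t) v (fp (cosp (at_axis q i))) (fp (sinp (at_axis q i))))
  as (M1 & M2 & M3).
unfold f in Fi; fold v in Fi.
repeat split; apply Sq; lra.
Qed.

Lemma one_fp_value : IZR one_fp = 73786976294838206464.
Proof. reflexivity. Qed.

(** The constant [1.25e-11] exceeds the square root of [7100 ^ 2 * 32 * (60 * 2 ^ -112 / 0.1218)], the
    contribution of the residuals; that of the rounding of the starting state is negligible. *)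
Lemma arrival (h r : Z) (q : state) :
  0.1218 <= fp h -> 32 * fp h <= 3.8988329 ->
  integrate steps order h (start_state r) = Some q ->
  near_state (start (start_angle r)) q (launch (start_angle r)) (32 * fp h) 1.25e-11.
Proof.
intros Hlo Hhi HI.
assert (Hh : (0 < h)%Z).
{ apply lt_IZR; apply (Rmult_lt_reg_r (/ IZR one_fp));
    [apply Rinv_0_lt_compat, one_fp_pos |].
  rewrite Rmult_0_l; unfold fp, Rdiv in Hlo; lra. }
apply near_of_gap; [lra |].
pose proof (integrate_sound (start (start_angle r)) steps order h (start_state r) q
  (launch (start_angle r)) 0 Hh (launch_solution _) HI) as G.
assert (EN : INR steps = 32) by (unfold steps; simpl; ring).
rewrite EN, Rplus_0_l in G.
eapply Rle_trans; [exact G |].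
pose proof (gap_start r) as G0.
pose proof (exp_bound (32 * fp h) Hhi) as EB.
assert (W : 60 * (/ 2 ^ 56) ^ 2 / fp h <= 60 * (/ 2 ^ 56) ^ 2 / 0.1218).
{ apply Rmult_le_compat_l; [pose proof (pow2_ge_0 (/ 2 ^ 56)); lra |].
  apply Rinv_le_contravar; lra. }
apply Rle_trans with (7100 ^ 2 * (24 * (/ IZR one_fp) ^ 2 + 32 * (60 * (/ 2 ^ 56) ^ 2 / 0.1218))).
- apply Rmult_le_compat; [left; apply exp_pos | | exact EB | lra].
  apply Rplus_le_le_0_compat.
  + unfold state_gap, sum3.
    apply Rplus_le_le_0_compat; [apply Rplus_le_le_0_compat |]; apply mismatch_ge_0.
  + assert (0 <= 60 * (/ 2 ^ 56) ^ 2 / fp h); [|lra].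
    apply Rmult_le_pos; [pose proof (pow2_ge_0 (/ 2 ^ 56)); lra |].
    left; apply Rinv_0_lt_compat; lra.
- rewrite one_fp_value; lra.
Qed.

(** The parameter of the periodic orbit lies between those of [r_low] and [r_high].  The step lengths
    [h_low] and [h_high] are such that 32 steps lead to [x = PI / 4 + 2 PI], up to rounding. *)
Definition r_low : Z := 158056308502.
Definition r_high : Z := 158056308622.
Definition h_low : Z := 8990091633164412764.
Definition h_high : Z := 8990091634772886449.
(** [2 PI], rounded. *)
Definition two_pi_fp : Z := 463617245316935861932.

(** The integration succeeds, its displacement in [x] is [2 PI] up to [10 ^ 6] fixed-point units, about
    [1.4e-14], and its final state satisfies [test]. *)
Definition arrives (h r : Z) (test : state -> bool) : bool :=
  match integrate steps order h (start_state r) with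
  | Some q => (Z.abs (disp (vx q) - two_pi_fp) <=? 10 ^ 6)%Z && test q
  | None => false
  end.

(** In the final state, [y + z - PI / 2 >= 1e-10] and [x' >= 1.34]. *)
Definition ends_above (q : state) : bool :=
  ((one_fp <=? 10 ^ 10 * (disp (vy q) + disp (vz q))) &&
   (134 * one_fp <=? 100 * (sinp (vz q) + cosp (vy q))))%Z.
(** In the final state, [y + z - PI / 2 <= - 1e-10]. *)
Definition ends_below (q : state) : bool :=
  (10 ^ 10 * (disp (vy q) + disp (vz q)) <=? - one_fp)%Z.

Lemma arrives_low : arrives h_low r_low ends_above = true.
Proof. vm_cast_no_check (eq_refl true). Qed.

Lemma arrives_high : arrives h_high r_high ends_below = true.
Proof. vm_cast_no_check (eq_refl true). Qed.

Definition a_low : R := start_angle r_low.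
Definition a_high : R := start_angle r_high.
Definition T_low : R := 32 * fp h_low.
Definition T_high : R := 32 * fp h_high.

Lemma T_low_bounds : 3.89883075 <= T_low <= 3.898830752.
Proof. unfold T_low, fp, h_low; rewrite one_fp_value; lra. Qed.

Lemma T_high_bounds : 3.898830752 <= T_high <= 3.898830753.
Proof. unfold T_high, fp, h_high; rewrite one_fp_value; lra. Qed.

Lemma arrives_state (h r : Z) (test : state -> bool) :
  arrives h r test = true ->
  exists q, integrate steps order h (start_state r) = Some q
    /\ (Z.abs (disp (vx q) - two_pi_fp) <=? 10 ^ 6)%Z = true /\ test q = true.
Proof.
unfold arrives; intros H.
destruct (integrate steps order h (start_state r)) as [q|]; [|discriminate].
apply andb_true_iff in H as [H1 H2]; exists q; auto.
Qed.

Lemma near_state_full_turn (o : axis -> R) (q : state) (u : axis -> R -> R) (t : R) :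
  near_state o q u t 1.25e-11 ->
  (Z.abs (disp (vx q) - two_pi_fp) <=? 10 ^ 6)%Z = true ->
  Rabs (u ax t - (o ax + 2 * PI)) <= 1.3e-11.
Proof.
intros N H; apply Z.leb_le, IZR_le in H; rewrite abs_IZR, minus_IZR in H.
destruct (N ax) as [Nx _]; cbn [at_axis] in Nx.
pose proof PI_bounds.
assert (B : Rabs (fp (disp (vx q)) - 2 * PI) <= 5e-13).
{ apply Rabs_le_between in H; unfold two_pi_fp in H; unfold fp; rewrite one_fp_value.
  apply Rabs_le; simpl (10 ^ 6)%Z in H; lra. }
apply Rabs_le_between in B; apply Rabs_le_between in Nx; apply Rabs_le; lra.
Qed.

Lemma arrives_sound (h r : Z) (test : state -> bool) :
  0.1218 <= fp h -> 32 * fp h <= 3.8988329 -> arrives h r test = true ->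
  exists q, near_state (start (start_angle r)) q (launch (start_angle r)) (32 * fp h) 1.25e-11
    /\ Rabs (launch (start_angle r) ax (32 * fp h) - (PI / 4 + 2 * PI)) <= 1.3e-11
    /\ test q = true.
Proof.
intros Hlo Hhi H.
destruct (arrives_state h r test H) as (q & HI & Hx & Ht).
assert (N := arrival h r q Hlo Hhi HI).
exists q; split; [exact N | split; [|exact Ht]].
exact (near_state_full_turn _ q _ _ N Hx).
Qed.

(** ** The two extreme trajectories *)

Lemma low_end :
  Rabs (launch a_low ax T_low - (PI / 4 + 2 * PI)) <= 1.3e-11 /\
  7e-11 <= launch a_low ay T_low + launch a_low az T_low - PI / 2 /\
  1.33 <= field3 (fun j => launch a_low j T_low) ax.
Proof.
destruct (arrives_sound h_low r_low ends_above) as (q & N & X & H2);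
  [unfold fp, h_low; rewrite one_fp_value; lra ..| exact arrives_low |].
fold a_low T_low in N, X.
unfold ends_above in H2; apply andb_true_iff in H2 as [H2 H3].
split; [exact X | split].
- apply Z.leb_le, IZR_le in H2; rewrite mult_IZR, plus_IZR in H2; simpl (10 ^ 10)%Z in H2.
  destruct (N ay) as [Ny _]; destruct (N az) as [Nz _]; cbn [at_axis start] in Ny, Nz.
  apply Rabs_le_between in Ny; apply Rabs_le_between in Nz.
  unfold fp in Ny, Nz; rewrite one_fp_value in *; lra.
- apply Z.leb_le, IZR_le in H3; rewrite !mult_IZR, plus_IZR in H3.
  destruct (N ay) as (Ny & Cy & _); destruct (N az) as (Nz & _ & Sz).
  cbv zeta in *; cbn [at_axis] in *.
  unfold field3; cbn [prv nxt].
  pose proof (sin_lipschitz (start a_low az + fp (disp (vz q))) (launch a_low az T_low)) as Ls.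
  pose proof (cos_lipschitz (start a_low ay + fp (disp (vy q))) (launch a_low ay T_low)) as Lc.
  apply (fun H => Rle_trans _ _ _ H Nz) in Ls; apply (fun H => Rle_trans _ _ _ H Ny) in Lc.
  apply Rabs_le_between in Ls; apply Rabs_le_between in Lc.
  apply Rabs_le_between in Cy; apply Rabs_le_between in Sz.
  set (cy := cos (start a_low ay + _)) in *; set (sz := sin (start a_low az + _)) in *.
  clearbody cy sz; unfold fp in Cy, Sz; rewrite one_fp_value in H3, Cy, Sz; lra.
Qed.

Lemma high_end :
  Rabs (launch a_high ax T_high - (PI / 4 + 2 * PI)) <= 1.3e-11 /\
  launch a_high ay T_high + launch a_high az T_high - PI / 2 <= - 7e-11.
Proof.
destruct (arrives_sound h_high r_high ends_below) as (q & N & X & H2);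
  [unfold fp, h_high; rewrite one_fp_value; lra ..| exact arrives_high |].
fold a_high T_high in N, X.
unfold ends_below in H2.
split; [exact X |].
- apply Z.leb_le, IZR_le in H2; rewrite mult_IZR, plus_IZR, opp_IZR in H2; simpl (10 ^ 10)%Z in H2.
  destruct (N ay) as [Ny _]; destruct (N az) as [Nz _]; cbn [at_axis start] in Ny, Nz.
  apply Rabs_le_between in Ny; apply Rabs_le_between in Nz.
  unfold fp in Ny, Nz; rewrite one_fp_value in *; lra.
Qed.

(** ** The trajectories in between *)

Lemma angle_gap : a_low <= a_high <= a_low + 2.4e-10.
Proof.
unfold a_low, a_high, start_angle.
assert (Hx : IZR r_high / IZR denom - IZR r_low / IZR denom = 1.2e-10)
  by (unfold r_high, r_low; change (IZR denom) with 1000000000000; lra).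
split.
- assert (atan (IZR r_low / IZR denom) < atan (IZR r_high / IZR denom)); [|lra].
  apply atan_increasing; lra.
- assert (L : Rabs (atan (IZR r_high / IZR denom) - atan (IZR r_low / IZR denom))
    <= 1 * Rabs (IZR r_high / IZR denom - IZR r_low / IZR denom)).
  { apply (lipschitz_of_derive_bound atan (fun x => / (1 + x ^ 2))).
    - intros t; apply is_derive_Reals, derivable_pt_lim_atan.
    - intros t; pose proof (pow2_ge_0 t).
      rewrite Rabs_pos_eq by (left; apply Rinv_0_lt_compat; lra).
      rewrite <- Rinv_1; apply Rinv_le_contravar; lra. }
  rewrite Hx, (Rabs_pos_eq 1.2e-10) in L by lra; apply Rabs_le_between in L; lra.
Qed.

(** In the window [[3.8988286, 3.8988329]], of half-width about [2.15e-6], the trajectories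
    with parameter between [a_low] and [a_high] stay within [1e-5] of the end of the lower one. *)
Lemma x_fast (a t : R) : a_low <= a <= a_high -> 3.8988286 <= t <= 3.8988329 ->
  1.3 <= field3 (fun j => launch a j t) ax.
Proof.
intros Ha Ht; destruct low_end as (_ & _ & F).
pose proof angle_gap as Hg; pose proof T_low_bounds as HT.
assert (B : forall i, Rabs (launch a i t - launch a_low i T_low) <= 1e-5).
{ intros i.
  pose proof (launch_time_lipschitz a i T_low t) as L1.
  pose proof (launch_dependence a a_low i T_low ltac:(lra)) as L2.
  assert (Rabs (t - T_low) <= 2.2e-6) by (apply Rabs_le; lra).
  rewrite (Rabs_pos_eq (a - a_low)) in L2 by lra.
  replace (launch a i t - launch a_low i T_low) with
    ((launch a i t - launch a i T_low) + (launch a i T_low - launch a_low i T_low)) by ring.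
  eapply Rle_trans; [apply Rabs_triang | lra]. }
pose proof (field3_lipschitz (fun j => launch a j t) (fun j => launch a_low j T_low) ax) as L.
pose proof (B (prv ax)); pose proof (B (nxt ax)); cbv beta in L.
assert (L' : Rabs (field3 (fun j => launch a j t) ax - field3 (fun j => launch a_low j T_low) ax)
  <= 2e-5) by lra.
apply Rabs_le_between in L'; lra.
Qed.

Lemma x_increment (a t t' : R) : a_low <= a <= a_high -> 3.8988286 <= t -> t <= t' ->
  t' <= 3.8988329 -> 1.3 * (t' - t) <= launch a ax t' - launch a ax t.
Proof.
intros Ha H1 H2 H3.
assert (H : launch a ax t - 1.3 * t <= launch a ax t' - 1.3 * t'); [|lra].
apply (derive_nonneg_le (fun s => launch a ax s - 1.3 * s)
  (fun s => field3 (fun j => launch a j s) ax - 1.3)); [exact H2 | |].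
- intros s _; apply (is_derive_minus (launch a ax) (fun s => 1.3 * s)); [apply launch_solution |].
  auto_derive; [exact I | ring].
- intros s Hs; pose proof (x_fast a s Ha ltac:(lra)); lra.
Qed.

(** Two times at which [x] differs by at most [1.3e-11] differ by at most [1.3e-11 / 1.3]. *)
Lemma hitting_time (a t T : R) : a_low <= a <= a_high -> 
  3.8988286 <= t <= 3.8988329 -> 3.8988286 <= T <= 3.8988329 ->
  Rabs (launch a ax T - launch a ax t) <= 1.3e-11 -> Rabs (T - t) <= 1e-11.
Proof.
intros Ha Ht HT H; apply Rabs_le_between in H; apply Rabs_le.
destruct (Rle_dec t T).
- pose proof (x_increment a t T Ha ltac:(lra) ltac:(lra) ltac:(lra)); lra.
- pose proof (x_increment a T t Ha ltac:(lra) ltac:(lra) ltac:(lra)); lra.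
Qed.

(** Signed distance to the plane [y + z = PI / 2], up to a constant factor. *)
Definition height (a t : R) : R := launch a ay t + launch a az t - PI / 2.

Lemma height_time_lipschitz a t t' : Rabs (height a t - height a t') <= 4 * Rabs (t - t').
Proof.
pose proof (launch_time_lipschitz a ay t' t) as L1; pose proof (launch_time_lipschitz a az t' t) as L2.
unfold height.
replace (_ - _) with ((launch a ay t - launch a ay t') + (launch a az t - launch a az t')) by ring.
eapply Rle_trans; [apply Rabs_triang | lra].
Qed.

(** The arc from the symmetry line through [x = PI / 4] to its translate through
    [x = PI / 4 + 2 PI]. *)
Lemma symmetric_arc_exists :
  exists a T, 3.8988286 <= T <= 3.8988329 /\
    launch a ax T = PI / 4 + 2 * PI /\ launch a ay T + launch a az T = PI / 2.
Proof.
pose proof angle_gap as Hg; pose proof T_low_bounds as HTl; pose proof T_high_bounds as HTh.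
destruct low_end as (Xl & Gl & _); destruct high_end as (Xh & Gh).
destruct (shooting (fun a t => launch a ax t) height a_low a_high 3.8988286 3.8988329
   (PI / 4 + 2 * PI) 1.3 4 21300) as (a & T & Ha & HT & E1 & E2); try lra.
- exact x_increment.
- intros s t; apply (ex_derive_continuous (launch s ax)); eexists; apply launch_solution.
- intros s s' t _ _ Ht.
  pose proof (launch_dependence s s' ax t ltac:(lra)); pose proof (Rabs_pos (s - s')); lra.
- intros s s' t _ _ Ht.
  pose proof (launch_dependence s s' ay t ltac:(lra)) as L1;
  pose proof (launch_dependence s s' az t ltac:(lra)) as L2.
  unfold height.
  replace (_ - _) with ((launch s ay t - launch s' ay t) + (launch s az t - launch s' az t)) by ring.
  eapply Rle_trans; [apply Rabs_triang | lra].
- exact height_time_lipschitz.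
- (* The spread [10650 * 2.4e-10] in [x] is less than [1.3 * 2.14e-6]. *)
  intros s Hs.
  pose proof (launch_dependence s a_low ax T_low ltac:(lra)) as L.
  rewrite (Rabs_pos_eq (s - a_low)) in L by lra.
  pose proof (x_increment s 3.8988286 T_low Hs ltac:(lra) ltac:(lra) ltac:(lra)).
  pose proof (x_increment s T_low 3.8988329 Hs ltac:(lra) ltac:(lra) ltac:(lra)).
  apply Rabs_le_between in L; apply Rabs_le_between in Xl; lra.
- intros t Ht E; rewrite <- E in Xl.
  pose proof (hitting_time a_low t T_low ltac:(lra) Ht ltac:(lra) Xl).
  pose proof (height_time_lipschitz a_low t T_low) as L.
  rewrite Rabs_minus_sym in H; apply Rabs_le_between in L; unfold height in *; lra.
- intros t Ht E; rewrite <- E in Xh.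
  pose proof (hitting_time a_high t T_high ltac:(lra) Ht ltac:(lra) Xh).
  pose proof (height_time_lipschitz a_high t T_high) as L.
  rewrite Rabs_minus_sym in H; apply Rabs_le_between in L; unfold height in *; lra.
- exists a, T; unfold height in E2; repeat split; try lra.
Qed.

Theorem theorem7p2 :
  exists (tau : R) (x y z : R -> R),
    7.797656 <= tau <= 7.797666 /\
    is_ABC_solution 1 1 1 x y z /\
    (forall t : R,
        x (t + tau) = x t + 4 * PI /\
        y (t + tau) = y t /\
        z (t + tau) = z t) /\
    ~ (forall t : R, x (t + tau) = x t + 2 * PI).
Proof.
destruct symmetric_arc_exists as (a & T & HT & X & YZ).
assert (P : forall t, launch a ax (t + 2 * T) = launch a ax t + 4 * PI /\
    launch a ay (t + 2 * T) = launch a ay t /\ launch a az (t + 2 * T) = launch a az t).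
{ apply symmetric_arc_periodic; try assumption.
  - apply launch_solution.
  - apply launch_0.
  - rewrite !launch_0; unfold start; ring. }
exists (2 * T), (launch a ax), (launch a ay), (launch a az).
split; [lra | split; [|split; [exact P |]]].
- intros t; rewrite !Rmult_1_l.
  exact (conj (launch_solution a ax t)
    (conj (launch_solution a ay t) (launch_solution a az t))).
- intros H; specialize (H 0); destruct (P 0) as [P0 _].
  pose proof PI_RGT_0; lra.
Qed.
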